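(* Let $a_1,\ldots,a_N$ be positive integers such that any $N-1$ of them have no common factor, and let $X=\mathbb{P}(a_1,\ldots,a_N)$ be the corresponding weighted projective space, so that $\dim X = N-1$. Let $a=a_1+\cdots+a_N$ and $p_i=a_i/a$. Let $c_d$ denote the coefficient of $t^d$ in the regularized quantum period of $X$, \[ \widehat{G}_X(t)=\sum_{k=0}^\infty \frac{(ak)!}{(a_1k)!\,(a_2k)!\cdots(a_Nk)!}\,t^{ak}. \] Then $c_d=0$ unless $d$ is divisible by $a$, and the non-zero coefficients $c_d$ satisfy \[ \log c_d \sim A d-\frac{\dim X}{2}\log d + B \] as $d\to\infty$, meaning that $\log c_d-\left(Ad-\frac{\dim X}{2}\log d+B\right)\to 0$ as $d\to\infty$ through those $d$ with $c_d\neq 0$, where \[ A=-\sum_{i=1}^N p_i\log p_i,\qquad B=-\frac{\dim X}{2}\log(2\pi)-\frac12\sum_{i=1}^N\log p_i . \]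
   Context: The weighted projective space $\mathbb{P}(a_1,\ldots,a_N)$ is the quotient $(\mathbb{C}^N\setminus\{0\})/\mathbb{C}^\times$, where $\lambda\in\mathbb{C}^\times$ acts by $(x_1,\ldots,x_N)\mapsto(\lambda^{a_1}x_1,\ldots,\lambda^{a_N}x_N)$; it has dimension $N-1$. The regularized quantum period of $X$ is a generating function of Gromov--Witten invariants of $X$; for weighted projective spaces it is given by the closed formula displayed in the claim, which may be taken as its definition here. $\log$ is the natural logarithm. *)

(* Defs.v *)
From HB Require Import structures.
From mathcomp Require Import all_boot all_order all_algebra.
From mathcomp Require Import all_classical all_reals all_analysis.
Import Order.TTheory GRing.Theory Num.Theory.
Import numFieldNormedType.Exports.

Set Implicit Arguments.
Unset Strict Implicit.
Unset Printing Implicit Defensive.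

Local Open Scope ring_scope.

(* The gcd of the empty family is 0, since every integer divides all of its
   members.  Hence well_formed excludes N <= 1, where N.-1 = 0. *)
Definition well_formed (N : nat) (a : 'I_N -> nat) : Prop :=
  forall S : {set 'I_N}, #|S| = N.-1 -> \big[gcdn/0%N]_(i in S) a i = 1%N.

Definition wps_dim (N : nat) (a : 'I_N -> nat) : nat := N.-1.

Definition weight_sum (N : nat) (a : 'I_N -> nat) : nat :=
  (\sum_(i < N) a i)%N.

Definition weight_frac (R : realType) (N : nat) (a : 'I_N -> nat) (i : 'I_N) : R :=
  (a i)%:R / (weight_sum a)%:R.

Definition period_term (R : realType) (N : nat) (a : 'I_N -> nat) (k : nat) : R :=
  ((weight_sum a * k)`!)%:R / \prod_(i < N) ((a i * k)`!)%:R.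

Definition period_partial_sum (R : realType) (N : nat) (a : 'I_N -> nat)
    (n : nat) : {poly R} :=
  \sum_(k < n) period_term R a k *: 'X^(weight_sum a * k).

(* The regularized quantum period is the t-adic limit of its partial sums.  When
   the weight sum is positive, the terms with k > d have degree > d, so the
   coefficient of t^d is already that of the sum over k <= d (see
   period_coefE). *)
Definition period_coef (R : realType) (N : nat) (a : 'I_N -> nat) (d : nat) : R :=
  (period_partial_sum R a d.+1)`_d.

Lemma period_coefE (R : realType) (N : nat) (a : 'I_N -> nat) (n d : nat) :
  (0 < weight_sum a)%N -> (d < n)%N ->
  (period_partial_sum R a n)`_d = period_coef R a d.
Proof.
move=> a_gt0; elim: n => // n IHn; rewrite ltnS leq_eqVlt => /predU1P[-> //|dn].
rewrite -IHn // /period_partial_sum big_ord_recr coefD coefZ coefXn /=.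
rewrite ltn_eqF ?mulr0 ?addr0 //.
by rewrite (leq_trans dn) // leq_pmull.
Qed.

(* Main.v *)
(** Put [s n = ln n! - (n + 1/2) ln n + n].  The elementary bounds
    [2 (x - 1) / (x + 1) <= ln x <= (x - 1/x) / 2] for [x >= 1], applied to
    [x = (n + 1) / n], show that [s n] decreases while [s n - 1 / (4 n)]
    increases, so [s] converges; Wallis' product identifies the limit as
    [ln (2 pi) / 2].  Expressing every factorial in [ln c_d] through [s], all
    other terms add up exactly to [A d - (dim X / 2) ln d] and the [p_i] part of
    [B], and what remains is [s d - \sum_i s (a_i d / a)], which tends to
    [(1 - N) ln (2 pi) / 2]. *)

Require Import Defs.
From HB Require Import structures.
From mathcomp Require Import all_boot all_order all_algebra.
From mathcomp Require Import all_classical all_reals all_analysis.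
From mathcomp Require Import ring lra.
Import Order.TTheory GRing.Theory Num.Theory.
Import numFieldNormedType.Exports.

Local Open Scope classical_set_scope.
Local Open Scope ring_scope.

(** * Rational bounds on the logarithm *)

Lemma is_derive_ge0_le (R : realType) (f df : R -> R) (x y : R) :
  x <= y -> (forall z, x <= z <= y -> is_derive z 1 f (df z)) ->
  (forall z, x <= z <= y -> 0 <= df z) -> f x <= f y.
Proof.
move=> xy fdf df_ge0.
have fcont : {within `[x, y], continuous f}.
  apply: derivable_within_continuous => z; rewrite in_itv /= => /fdf dfz.
  exact: ex_derive.
have fdf' z : z \in `]x, y[%R -> is_derive z 1 f (df z).
  by rewrite in_itv /= => /andP[/ltW xz /ltW zy]; apply: fdf; rewrite xz.
have [z] := MVT_segment xy fdf' fcont.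
rewrite in_itv /= => zxy fyx.
by rewrite -subr_ge0 fyx mulr_ge0 ?subr_ge0 // df_ge0.
Qed.

(** The left side is [2 - 4 / (x + 1)], and [ln t + 4 / (t + 1)] equals 2 at 1 and has derivative
    [(t - 1)^2 / (t (t + 1)^2)]. *)
Lemma ln_ge_pade (R : realType) (x : R) : 1 <= x -> 2 * (x - 1) / (x + 1) <= ln x.
Proof.
move=> x_ge1.
pose g (t : R) := ln t + 4 * (t + 1)^-1.
pose dg (t : R) := t^-1 - 4 * (t + 1) ^- 2.
suff: g 1 <= g x.
  have -> : 2 * (x - 1) / (x + 1) = 2 - 4 * (x + 1)^-1 by field; lra.
  by rewrite /g ln1 -[1 + 1]/2%:R; lra.
apply: (@is_derive_ge0_le _ g dg _ _ x_ge1) => t /andP[t1 _].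
- have t0 : 0 < t by lra.
  have t10 : t + 1 != 0 by lra.
  have dt : is_derive t 1 (fun t : R => (t + 1)^-1) (- (t + 1) ^- 2 *: (1 + 0)).
    exact: (@is_deriveV _ (fun t => t + 1)).
  have := is_deriveD (is_derive1_ln t0) (is_deriveZ 4 dt).
  by congr (is_derive _ _ _ _); rewrite /dg /GRing.scale /=; ring.
- have -> : dg t = (t - 1) ^+ 2 / (t * (t + 1) ^+ 2).
    by rewrite /dg; field; apply/andP; split; lra.
  by rewrite divr_ge0 ?sqr_ge0 // mulr_ge0 ?sqr_ge0 //; lra.
Qed.

(** The right side is the trapezoid rule for [1/t] on [[1, x]]; right minus left has derivative
    [(t - 1)^2 / (2 t^2)]. *)
Lemma ln_le_trapezoid (R : realType) (x : R) : 1 <= x -> ln x <= (x - x^-1) / 2.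
Proof.
move=> x_ge1.
pose g (t : R) := 2^-1 * (t - t^-1) - ln t.
pose dg (t : R) := 2^-1 * (1 + t ^- 2) - t^-1.
suff: g 1 <= g x by rewrite /g ln1; lra.
apply: (@is_derive_ge0_le _ g dg _ _ x_ge1) => t /andP[t1 _].
- have t0 : 0 < t by lra.
  have dt : is_derive t 1 (fun t : R => t^-1) (- t ^- 2 *: 1).
    by apply: (@is_deriveV _ id); rewrite gt_eqF.
  have := is_deriveB (is_deriveZ 2^-1 (is_deriveB (is_derive_id t 1) dt)) (is_derive1_ln t0).
  by congr (is_derive _ _ _ _); rewrite /dg /GRing.scale /=; ring.
- have -> : dg t = (t - 1) ^+ 2 / (2 * t ^+ 2).
    by rewrite /dg; field; lra.
  by rewrite divr_ge0 ?sqr_ge0 // mulr_ge0 ?sqr_ge0 //; lra.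
Qed.

(** * Wallis integrals *)

(* An antiderivative of [cos ^+ n] vanishing at 0, by the reduction formula. *)
Fixpoint cosX_primitive (R : realType) (n : nat) (x : R) : R :=
  match n with
  | 0 => x
  | 1 => sin x
  | (m.+1 as m1).+1 =>
    (cos x ^+ m1 * sin x + m1%:R * cosX_primitive R m x) / m1.+1%:R
  end.

(** The integral of [cos ^+ n] over [[0, pi / 2]]. *)
Definition wallis (R : realType) (n : nat) : R := cosX_primitive R n (pi / 2).

Lemma cosX_primitiveSS (R : realType) (n : nat) (x : R) :
  cosX_primitive R n.+2 x =
  (cos x ^+ n.+1 * sin x + n.+1%:R * cosX_primitive R n x) / n.+2%:R.
Proof. by []. Qed.

Lemma nat_ind2 (P : nat -> Prop) :
  P 0%N -> P 1%N -> (forall n, P n -> P n.+2) -> forall n, P n.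
Proof.
move=> P0 P1 PSS n; suff: P n /\ P n.+1 by case.
by elim: n => // n [Pn Pn1]; split=> //; apply: PSS.
Qed.

Lemma is_derive_cosX_primitive (R : realType) (n : nat) (x : R) :
  is_derive x 1 (cosX_primitive R n) (cos x ^+ n).
Proof.
elim/nat_ind2: n => [||n IHn].
- by rewrite expr0; apply: is_derive_id.
- by rewrite expr1; apply: is_derive_sin.
- have fE : cosX_primitive R n.+2 = n.+2%:R^-1 *:
      ((cos : R -> R) ^+ n.+1 * sin + n.+1%:R *: cosX_primitive R n).
    apply/funext => y; rewrite cosX_primitiveSS mulrC.
    by rewrite /GRing.scale /= !fctE.
  rewrite fE.
  apply: is_derive_eq (is_deriveZ n.+2%:R^-1
    (is_deriveD (is_deriveM (is_deriveX n.+1 (is_derive_cos x)) (is_derive_sin x))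
                (is_deriveZ n.+1%:R IHn))) _.
  rewrite /GRing.scale /= !fctE.
  have := sin2cos2 x; set s := sin x; set c := cos x => sE.
  have n2 : n.+2%:R != 0 :> R by rewrite pnatr_eq0.
  apply: (mulfI n2); rewrite mulVKf //.
  rewrite -[n.+2]addn2 -[n.+1]addn1 !natrD !exprD expr1.
  (* Isolates [1 - s ^+ 2], so that [sE] leaves only powers of [c]. *)
  have -> : c ^+ n * c * c + s * ((n%:R + 1) * c ^+ n * - s) + (n%:R + 1) * c ^+ n =
     c ^+ n * c * c + (n%:R + 1) * c ^+ n * (1 - s ^+ 2) by ring.
  by rewrite sE; ring.
Qed.

Lemma cosX_primitive0 (R : realType) (n : nat) : cosX_primitive R n 0 = 0.
Proof.
elim/nat_ind2: n => [||n IHn] //; first exact: sin0.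
by rewrite cosX_primitiveSS IHn sin0 !mulr0 addr0 mul0r.
Qed.

Lemma wallisSS (R : realType) (n : nat) :
  wallis R n.+2 = n.+1%:R / n.+2%:R * wallis R n.
Proof.
by rewrite /wallis cosX_primitiveSS cos_pihalf expr0n mul0r add0r mulrAC.
Qed.

Lemma wallis0 (R : realType) : wallis R 0 = pi / 2. Proof. by []. Qed.

Lemma wallis1 (R : realType) : wallis R 1 = 1. Proof. exact: sin_pihalf. Qed.

Lemma wallis_gt0 (R : realType) (n : nat) : 0 < wallis R n.
Proof.
elim/nat_ind2: n => [||n IHn].
- by rewrite wallis0 divr_gt0 ?pi_gt0.
- by rewrite wallis1.
- by rewrite wallisSS mulr_gt0 ?divr_gt0.
Qed.

(** The difference of the two primitives vanishes at 0 and has derivative [cos^n (1 - cos)],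
    nonnegative on [[0, pi / 2]]. *)
Lemma wallis_le (R : realType) (n : nat) : wallis R n.+1 <= wallis R n.
Proof.
rewrite -subr_ge0 /wallis.
pose f := cosX_primitive R n - cosX_primitive R n.+1.
have -> : 0 = f 0 by rewrite /f !fctE !cosX_primitive0 subrr.
have pi0 := pi_gt0 R.
apply: (@is_derive_ge0_le _ f (fun x => cos x ^+ n - cos x ^+ n.+1)); first lra.
  move=> z _; exact: (is_deriveB (is_derive_cosX_primitive R n z)
                                 (is_derive_cosX_primitive R n.+1 z)).
move=> z /andP[z0 zpi].
have c0 : 0 <= cos z by apply: cos_ge0_pihalf; apply/andP; split; lra.
have c1 := cos_le1 z.
by rewrite exprS -{1}[_ ^+ n]mul1r -mulrBl mulr_ge0 ?subr_ge0 ?exprn_ge0.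
Qed.

(** By the reduction formula the product does not change from [n] to [n.+1]. *)
Lemma wallisM (R : realType) (n : nat) :
  n.+1%:R * wallis R n * wallis R n.+1 = pi / 2.
Proof.
elim: n => [|n IHn]; first by rewrite wallis0 wallis1 mul1r mulr1.
rewrite wallisSS -IHn; field; by rewrite -natrD pnatr_eq0.
Qed.

Lemma wallis_double (R : realType) (n : nat) :
  wallis R n.*2 = n.*2`!%:R / (4 ^+ n * n`!%:R ^+ 2) * (pi / 2).
Proof.
elim: n => [|n IHn]; first by rewrite wallis0 expr0 fact0 expr1n mulr1 divr1 mul1r.
rewrite doubleS wallisSS IHn !factS !natrM (exprS 4).
have f0 k : k`!%:R != 0 :> R by rewrite pnatr_eq0 -lt0n fact_gt0.
have k0 k : k.+1%:R != 0 :> R by rewrite pnatr_eq0.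
have -> : n.*2.+2%:R = 2 * n.+1%:R :> R by rewrite -natrM -doubleS -mul2n.
have w4 : 4 ^+ n != 0 :> R by rewrite expf_neq0 // pnatr_eq0.
by field; rewrite f0 w4 nat1r k0.
Qed.

(** * Convergence of the Stirling remainder *)

Definition stirling_rem (R : realType) (n : nat) : R :=
  ln n`!%:R - (n%:R + 1 / 2) * ln n%:R + n%:R.

Lemma stirling_remB (R : realType) (n : nat) : (0 < n)%N ->
  stirling_rem R n - stirling_rem R n.+1 =
  (n%:R + 1 / 2) * ln (n.+1%:R / n%:R) - 1.
Proof.
move=> n0; rewrite /stirling_rem factS natrM.
have nR : 0 < n%:R :> R by rewrite ltr0n.
have fR : 0 < n`!%:R :> R by rewrite ltr0n fact_gt0.
have n1R : 0 < n.+1%:R :> R by rewrite ltr0n.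
rewrite lnM ?ln_div ?posrE //; move: (ln n.+1%:R) => L.
by rewrite -natr1; ring.
Qed.

Lemma stirling_rem_decr (R : realType) (n : nat) : (0 < n)%N ->
  stirling_rem R n.+1 <= stirling_rem R n.
Proof.
move=> n0; rewrite -subr_ge0 stirling_remB //.
have nR : 0 < n%:R :> R by rewrite ltr0n.
have -> : n.+1%:R / n%:R = 1 + n%:R^-1 :> R by rewrite -natr1; field; lra.
have iR : 0 < n%:R^-1 :> R by rewrite invr_gt0.
have := @ln_ge_pade R (1 + n%:R^-1); rewrite lerDl => /(_ (ltW iR)).
(* At [x = 1 + 1/n] the lower bound is exactly the inverse of the factor [n + 1/2]. *)
have -> : 2 * (1 + n%:R^-1 - 1) / (1 + n%:R^-1 + 1) = (n%:R + 1 / 2)^-1 :> R.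
  by field; apply/andP; split; lra.
rewrite -(ler_pM2l (_ : 0 < n%:R + 1 / 2 :> R)); last lra.
rewrite mulfV; lra.
Qed.

Lemma stirling_rem_incr (R : realType) (n : nat) : (0 < n)%N ->
  stirling_rem R n - (4 * n%:R)^-1 <= stirling_rem R n.+1 - (4 * n.+1%:R)^-1.
Proof.
move=> n0; rewrite -subr_ge0.
have nR : 0 < n%:R :> R by rewrite ltr0n.
suff : (n%:R + 1 / 2) * ln (n.+1%:R / n%:R) - 1 <= (4 * n%:R)^-1 - (4 * n.+1%:R)^-1 :> R.
  rewrite -stirling_remB //.
  by move: ((4 * n%:R)^-1 : R) ((4 * n.+1%:R)^-1 : R) => u v; lra.
have -> : n.+1%:R / n%:R = 1 + n%:R^-1 :> R by rewrite -natr1; field; lra.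
have iR : 0 < n%:R^-1 :> R by rewrite invr_gt0.
have := @ln_le_trapezoid R (1 + n%:R^-1); rewrite lerDl => /(_ (ltW iR)).
rewrite -(ler_pM2l (_ : 0 < n%:R + 1 / 2 :> R)); last lra.
move=> /le_trans/(_ (_ : _ <= (4 * n%:R)^-1 - (4 * n.+1%:R)^-1 + 1)) H.
(* Equality holds: at [x = 1 + 1/n] the upper bound times [n + 1/2] is [1 + 1 / (4 n (n + 1))],
   whose last term telescopes. *)
rewrite lerBlDr; apply: H; rewrite -natr1 le_eqVlt; apply/orP; left; apply/eqP.
by field; do ?[apply/andP; split]; lra.
Qed.

Lemma is_cvg_stirling_rem (R : realType) : cvgn (stirling_rem R).
Proof.
(* Monotonicity is only known from index 1 on, hence the shift. *)
suff H : cvgn (fun n => stirling_rem R (n + 1)%N).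
  by apply/cvg_ex; have /cvg_ex[l] := H; rewrite (cvg_shiftn 1); exists l.
apply: nonincreasing_is_cvgn.
  apply/nonincreasing_seqP => n; rewrite addSn addn1.
  exact: stirling_rem_decr.
exists (stirling_rem R 1 - (4 * 1%:R)^-1) => _ [n _ <-].
have: stirling_rem R 1 - (4 * 1%:R)^-1 <=
      stirling_rem R n.+1 - (4 * n.+1%:R)^-1.
  elim: n => // n /le_trans; apply; exact: stirling_rem_incr.
rewrite addn1 => /le_trans; apply; rewrite lerBlDr lerDl invr_ge0 mulr_ge0 //.
Qed.

(** * Identification of the limit *)

(** Once the factorials of [wallis_double] are written through [stirling_rem], all terms in
    [n ln n], [n] and [ln n] cancel. *)
Lemma ln_wallis_double (R : realType) (n : nat) : (0 < n)%N ->
  2 * ln (wallis R n.*2) + ln (n.*2%:R) =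
  2 * (stirling_rem R n.*2 - 2 * stirling_rem R n) + 2 * ln 2 + 2 * ln (pi / 2).
Proof.
move=> n0; rewrite wallis_double /stirling_rem.
have q0 : 0 < pi / 2 :> R by rewrite divr_gt0 ?pi_gt0.
move: (pi / 2) q0 => q q0.
have nR : 0 < n%:R :> R by rewrite ltr0n.
have fR k : 0 < k`!%:R :> R by rewrite ltr0n fact_gt0.
have w0 : 0 < 4 ^+ n :> R by rewrite exprn_gt0.
have f0 : 0 < n`!%:R ^+ 2 :> R by rewrite exprn_gt0.
rewrite lnM ?posrE ?divr_gt0 ?mulr_gt0 // ln_div ?posrE ?mulr_gt0 // lnM ?posrE //.
rewrite !lnXn //; move: (ln n`!%:R) (ln n.*2`!%:R) => u v.
have -> : n.*2%:R = 2 * n%:R :> R by rewrite -muln2 natrM mulrC.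
have -> : ln 4 = 2 * ln 2 :> R.
  have -> : 4 = 2 ^+ 2 :> R by ring.
  by rewrite lnXn // mulr_natl.
rewrite (@lnM _ 2 n%:R) ?posrE //.
by field.
Qed.

Lemma wallis_bounds (R : realType) (n : nat) : (0 < n)%N ->
  ln (pi / 2) - n.*2%:R^-1 <= 2 * ln (wallis R n.*2) + ln (n.*2%:R) <= ln (pi / 2).
Proof.
move=> n0.
have q0 : 0 < pi / 2 :> R by rewrite divr_gt0 ?pi_gt0.
set m := n.*2; have m0 : 0 < m%:R :> R by rewrite ltr0n double_gt0.
have W0 := wallis_gt0 R m.
have W1 := wallis_gt0 R m.+1.
have -> : 2 * ln (wallis R m) + ln m%:R = ln (m%:R * wallis R m ^+ 2).
  by rewrite lnM ?posrE ?exprn_gt0 // lnXn // addrC mulr_natl.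
have M := wallisM R m; move: (pi / 2) q0 M => q q0 M; have S := wallisSS R m.
have le1 := wallis_le R m; have le2 := wallis_le R m.+1.
apply/andP; split.
- rewrite lerBlDr.
  (* With [W] for [wallis R]: [pi / 2 = (m + 1) W_m W_(m+1) <= (m + 1) W_m^2], and
     [ln (1 + 1/m) <= 1/m] bounds the cost of replacing [m + 1] by [m]. *)
  apply: (@le_trans _ _ (ln ((1 + m%:R^-1) * (m%:R * wallis R m ^+ 2)))).
    have i0 : 0 < m%:R^-1 :> R by rewrite invr_gt0.
    rewrite ler_ln ?posrE ?divr_gt0 ?mulr_gt0 ?exprn_gt0 ?addr_gt0 //.
    have -> : (1 + m%:R^-1) * (m%:R * wallis R m ^+ 2) = m.+1%:R * wallis R m * wallis R m.
      by rewrite -natr1; field; lra.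
    by rewrite -M ler_pM2l ?mulr_gt0.
  have [i0 P0] : 0 < m%:R^-1 :> R /\ 0 < m%:R * wallis R m ^+ 2.
    by rewrite invr_gt0 mulr_gt0 ?exprn_gt0.
  move: (m%:R * _) P0 => P P0; rewrite lnM ?posrE ?addr_gt0 //.
  rewrite addrC lerD2l le_ln1Dx //; apply: lt_trans i0; lra.
- rewrite ler_ln ?posrE ?divr_gt0 ?mulr_gt0 ?exprn_gt0 // -M.
  (* [W_(m+2)] is a multiple of [W_m], so the claim reduces to [m (m + 2) <= (m + 1)^2]. *)
  apply: (@le_trans _ _ (m.+1%:R * wallis R m * wallis R m.+2)); last first.
    by rewrite ler_pM2l ?mulr_gt0.
  rewrite S -!natr1 -(@ler_pM2r _ (m%:R + 1 + 1)); last lra.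
  have -> : (m%:R + 1) * wallis R m * ((m%:R + 1) / (m%:R + 1 + 1) * wallis R m) * (m%:R + 1 + 1) =
      (m%:R + 1) ^+ 2 * wallis R m ^+ 2.
    by field; lra.
  have -> : m%:R * wallis R m ^+ 2 * (m%:R + 1 + 1) =
      (m%:R + 1) ^+ 2 * wallis R m ^+ 2 - wallis R m ^+ 2 by ring.
  by rewrite gerBl sqr_ge0.
Qed.

(** One expression has two limits: one in terms of the unknown [l], the other [ln (pi / 2)] by
    squeezing. Equating them is a linear equation for [l]. *)
Lemma stirling_rem_cvg (R : realType) : stirling_rem R n @[n --> \oo] --> ln (2 * pi) / 2.
Proof.
have pi0 := pi_gt0 R.
have /cvg_ex[/= l sl] := is_cvg_stirling_rem R.
have cvg_dbl : n.*2 @[n --> \oo] --> \oo.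
  by under eq_fun do rewrite -mul2n; apply: cvg_mulnl.
have sl2 : stirling_rem R n.*2 @[n --> \oo] --> l := cvg_comp _ _ cvg_dbl sl.
have lim1 : 2 * (stirling_rem R n.*2 - 2 * stirling_rem R n) + 2 * ln 2 + 2 * ln (pi / 2)
    @[n --> \oo] --> 2 * (l - 2 * l) + 2 * ln 2 + 2 * ln (pi / 2).
  apply: cvgD; last exact: cvg_cst.
  apply: cvgD; last exact: cvg_cst.
  by apply: cvgMr; apply: cvgB => //; apply: cvgMr.
have lim2 : 2 * (stirling_rem R n.*2 - 2 * stirling_rem R n) + 2 * ln 2 + 2 * ln (pi / 2)
    @[n --> \oo] --> ln (pi / 2).
  apply: (@squeeze_cvgr _ _ _ _ (fun n => ln (pi / 2) - n.*2%:R^-1) (fun=> ln (pi / 2))).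
  - by near=> n; rewrite -ln_wallis_double ?wallis_bounds //; near: n; exact: nbhs_infty_gt.
  - rewrite -[X in _ --> X]subr0; apply: cvgB; first exact: cvg_cst.
    apply: (cvg_comp _ (fun k => k%:R^-1) cvg_dbl).
    rewrite -(cvg_shiftn 1); under eq_fun do rewrite addn1; exact: cvg_harmonic.
  - exact: cvg_cst.
have := cvg_unique _ lim1 lim2 => /(_ (@norm_hausdorff _ _) _).
rewrite (@lnM _ 2 pi) ?posrE // ln_div ?posrE // => E.
by have <- : l = (ln 2 + ln pi) / 2 by lra.
Unshelve. all: by end_near.
Qed.

(** * Coefficients of the period and their logarithms *)

Lemma ln_factE (R : realType) (n : nat) :
  ln n`!%:R = stirling_rem R n + (n%:R + 1 / 2) * ln n%:R - n%:R.
Proof. by rewrite /stirling_rem; ring. Qed.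

Lemma ln_prod (R : realType) (I : finType) (f : I -> R) :
  (forall i, 0 < f i) -> ln (\prod_i f i) = \sum_i ln (f i).
Proof.
move=> f0; suff [] : 0 < \prod_i f i /\ ln (\prod_i f i) = \sum_i ln (f i) by [].
elim/big_ind2: _ => [|x1 x2 y1 y2 [x0 <-] [y0 <-]|//]; first by rewrite ln1.
by rewrite mulr_gt0 // lnM.
Qed.

Lemma period_coef_dvd (R : realType) (N : nat) (a : 'I_N -> nat) (k : nat) :
  (0 < weight_sum a)%N -> period_coef R a (weight_sum a * k) = period_term R a k.
Proof.
move=> a0; rewrite /period_coef /period_partial_sum coef_sum.
have kd : (k < (weight_sum a * k).+1)%N by rewrite ltnS leq_pmull.
rewrite (bigD1 (Ordinal kd)) //= coefZ coefXn eqxx mulr1 big1 ?addr0 // => i ik.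
rewrite coefZ coefXn eqn_pmul2l // eq_sym.
by rewrite (_ : (_ == _) = false) ?mulr0 //; apply/negbTE.
Qed.

Lemma period_coef_ndvd (R : realType) (N : nat) (a : 'I_N -> nat) (d : nat) :
  ~~ (weight_sum a %| d)%N -> period_coef R a d = 0.
Proof.
move=> ad; rewrite /period_coef /period_partial_sum coef_sum big1 // => i _.
rewrite coefZ coefXn; case: eqP => [dE|_]; last by rewrite mulr0.
by rewrite dE dvdn_mulr in ad.
Qed.

(** An exact identity, resting on [a i * k = p i * d] and [\sum_i p i = 1]; the asymptotics enter
    only through [stirling_rem]. *)
Lemma ln_period_term (R : realType) (N : nat) (a : 'I_N -> nat) (k : nat) :
  (forall i, (0 < a i)%N) -> (0 < N)%N -> (0 < k)%N ->
  let p := weight_frac R a in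
  let d := (weight_sum a * k)%N in
  ln (period_term R a k) =
    stirling_rem R d - \sum_i stirling_rem R (a i * k)
    + (- \sum_i p i * ln (p i)) * d%:R - (wps_dim a)%:R / 2 * ln d%:R
    - 1 / 2 * \sum_i ln (p i).
Proof.
move=> a0 N0 k0 p d.
have A0 : (0 < weight_sum a)%N.
  by rewrite /weight_sum (bigD1 (Ordinal N0)) //= addn_gt0 a0.
have d0 : 0 < d%:R :> R by rewrite ltr0n muln_gt0 A0.
have p0 i : 0 < p i by rewrite divr_gt0 ?ltr0n.
have akE i : (a i * k)%:R = p i * d%:R :> R.
  rewrite /p /d /weight_frac !natrM; field.
  by rewrite pnatr_eq0 -lt0n.
have psum : \sum_i p i = 1.
  by rewrite /p /weight_frac -mulr_suml -natr_sum divff // pnatr_eq0 -lt0n.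
have fR n : 0 < n`!%:R :> R by rewrite ltr0n fact_gt0.
rewrite /period_term ln_div ?posrE ?prodr_gt0 // ln_prod // ln_factE -/d.
have -> : \sum_i ln (a i * k)`!%:R = \sum_i stirling_rem R (a i * k) +
    (\sum_i p i * ln (p i)) * d%:R + ln d%:R * d%:R + 1 / 2 * \sum_i ln (p i)
    + N%:R * (1 / 2 * ln d%:R) - d%:R.
  (* Each term free of [i] is spread over the index, with weights 1 or [p i], so that the identity
     can be checked summand by summand. *)
  have -> : N%:R * (1 / 2 * ln d%:R) = \sum_(i < N) (1 / 2 * ln d%:R) :> R.
    by rewrite sumr_const card_ord mulr_natl.
  have -> : ln d%:R * d%:R = \sum_i p i * (ln d%:R * d%:R) :> R.
    by rewrite -mulr_suml psum mul1r.
  have -> : - d%:R = - \sum_i p i * d%:R :> R by rewrite -mulr_suml psum mul1r.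
  rewrite mulr_suml mulr_sumr -sumrN -!big_split /=; apply: eq_bigr => i _.
  by rewrite ln_factE akE lnM ?posrE //; field.
rewrite -/d /wps_dim.
have -> : N.-1%:R = N%:R - 1 :> R by rewrite -[in RHS](prednK N0) -natr1 addrK.
by field.
Qed.

(** * Passage to the limit *)

Theorem theorem5 (R : realType) (N : nat) (a : 'I_N -> nat)
    (a_gt0 : forall i, (0 < a i)%N) (a_wf : well_formed a) :
  let p := weight_frac R a in
  let c := period_coef R a in
  let dimX : R := (wps_dim a)%:R in
  let A : R := - \sum_(i < N) p i * ln (p i) in
  let B : R := - (dimX / 2) * ln (2 * pi) - 1 / 2 * \sum_(i < N) ln (p i) in
  (forall d : nat, ~~ (weight_sum a %| d)%N -> c d = 0) /\
  (fun d : nat => ln (c d) - (A * d%:R - dimX / 2 * ln d%:R + B))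
    @ within [set d | c d != 0] \oo --> (0 : R).
Proof.
move=> p c dimX A B; split; first exact: period_coef_ndvd.
have N0 : (0 < N)%N.
  (* For [N = 0] the empty set has [N.-1 = 0] elements, and its gcd is 0 rather than 1. *)
  case: N a a_gt0 a_wf @p @c @dimX @A @B => // a _ /(_ finset.set0).
  by rewrite cards0 => /(_ erefl); rewrite big_set0.
have S0 : (0 < weight_sum a)%N.
  by rewrite /weight_sum (bigD1 (Ordinal N0)) //= addn_gt0 a_gt0.
(* The error term, extended to every [d] by the truncated quotient so that its limit can be taken
   along all integers and then restricted. *)
pose err d := stirling_rem R d - \sum_i stirling_rem R (a i * (d %/ weight_sum a))
  + dimX / 2 * ln (2 * pi).
have err0 : err d @[d --> \oo] --> (0 : R).
  (* The [1 - N] copies of [ln (2 * pi) / 2] cancel against the constant from [B], as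
     [N = dimX + 1]. *)
  have -> : 0 = ln (2 * pi) / 2 - \sum_(i < N) (ln (2 * pi) / 2) + dimX / 2 * ln (2 * pi).
    rewrite sumr_const card_ord -[_ *+ N]mulr_natl (_ : N%:R = dimX + 1);
      last by rewrite natr1 prednK.
    by field.
  apply: cvgD; last exact: cvg_cst.
  apply: cvgB; first exact: stirling_rem_cvg.
  apply: cvg_big => [|i _]; first exact: add_continuous.
  apply: (cvg_comp _ (stirling_rem R) _ (stirling_rem_cvg R)).
  apply: (cvg_comp _ (fun k => a i * k)%N); first exact: cvg_divnr S0.
  exact: cvg_mulnl.
apply: cvg_trans (cvg_within_filter [set d | c d != 0] err0).
apply: near_eq_cvg; rewrite near_withinE; near=> d => /= cd.
have /dvdnP[k dE] : (weight_sum a %| d)%N.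
  by apply: contraT => /(period_coef_ndvd R); rewrite -/(c d) => /eqP; rewrite (negbTE cd).
(* [d = 0] also has a nonzero coefficient; it is discarded because only large [d] matter. *)
have k0 : (0 < k)%N.
  have: (0 < d)%N by near: d; exact: nbhs_infty_gt.
  by rewrite dE muln_gt0 => /andP[].
rewrite /err dE mulnK // mulnC /c period_coef_dvd // ln_period_term // -/p -/A -/dimX /B.
by ring.
Unshelve. all: by end_near.
Qed.
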